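(* The notion of a Sasakian manifold in the new sense is equivalent to the notion of a Sasakian manifold in the old sense. That is: let $(\varphi,\vec\xi,\eta,g)$ be a contact metric structure on a smooth manifold $X$ of odd dimension $n$, with $\omega=d\eta$ non-degenerate on $D=\ker\eta$ and $\ker\omega=\mathrm{span}(\vec\xi)$. Then $P(N_\varphi)=0$ (Sasakian in the new sense) if and only if $N_\varphi+2d\eta\otimes\vec\xi=0$ (Sasakian in the old sense), where $P:TX\to D$ is the projection along $\mathrm{span}(\vec\xi)$ and $N_\varphi$ is the Nijenhuis torsion of $\varphi$.
   Context: All objects are $C^\infty$. An almost contact metric structure on $X$ is a tuple $(\varphi,\vec\xi,\eta,g)$, where $\varphi$ is a $(1,1)$-tensor field, $\vec\xi$ a vector field, $\eta$ a 1-form and $g$ a (pseudo-)Riemannian metric on $X$, such that $\eta(\vec\xi)=1$, $\varphi(\vec\xi)=0$, $\eta\circ\varphi=0$, $\varphi^2\vec X=-\vec X+\eta(\vec X)\vec\xi$ and $g(\varphi\vec X,\varphi\vec Y)=g(\vec X,\vec Y)-\eta(\vec X)\eta(\vec Y)$ for all vector fields $\vec X,\vec Y$. It is a contact metric structure if $\Omega=d\eta$, where $\Omega(\vec X,\vec Y)=g(\vec X,\varphi\vec Y)$. The Nijenhuis torsion is $N_\varphi(\vec X,\vec Y)=[\varphi\vec X,\varphi\vec Y]+\varphi^2[\vec X,\vec Y]-\varphi[\varphi\vec X,\vec Y]-\varphi[\vec X,\varphi\vec Y]$, and $P(N_\varphi)=0$ means $P(N_\varphi(\vec X,\vec Y))=0$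 for all vector fields $\vec X,\vec Y$ on $X$. Convention: $d\eta(\vec X,\vec Y)=\tfrac12\big(\vec X\eta(\vec Y)-\vec Y\eta(\vec X)-\eta([\vec X,\vec Y])\big)$. A Sasakian manifold in the old sense is a manifold with a contact metric structure that is normal, i.e. $N_\varphi+2d\eta\otimes\vec\xi=0$. A Sasakian manifold in the new sense is a manifold with a contact metric structure satisfying $P(N_\varphi)=0$. *)

(* Defs.v *)
(* Smooth manifolds are built here from topological spaces and smooth atlases.
   Tangent vectors at p are the derivations at p of the algebra of smooth
   functions, tensor fields are families of (multi)linear maps on the tangent
   spaces, and such a family is smooth when it takes smooth vector fields to
   smooth vector fields or functions. *)
From HB Require Import structures.
From mathcomp Require Import all_boot all_order all_algebra.
From mathcomp Require Import all_classical all_reals all_analysis.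
From mathcomp Require Import ring.

Set Implicit Arguments.
Unset Strict Implicit.
Unset Printing Implicit Defensive.

Import Order.TTheory GRing.Theory Num.Theory.
Import numFieldNormedType.Exports.

Local Open Scope classical_set_scope.
Local Open Scope ring_scope.

Section Differentiability_class.
Variables (R : realType) (V W : normedModType R).

(* Only meaningful for U open and V of finite dimension: all directional
   derivatives of order at most k exist and are continuous on U. *)
Fixpoint Ck_on (k : nat) (U : set V) (f : V -> W) : Prop :=
  (forall x, U x -> {for x, continuous f}) /\
  (if k is k'.+1 then
     forall v, (forall x, U x -> derivable f x v) /\ Ck_on k' U ('D_v f)
   else True).

Definition smooth_on (U : set V) (f : V -> W) : Prop :=
  forall k, Ck_on k U f.

End Differentiability_class.

Section Manifold.
Variables (R : realType) (n : nat).

(* [cinv] is a total function, relevant only on [chart_cod]. *)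
Record chart (M : topologicalType) := Chart {
  chart_dom : set M ;
  cmap : M -> 'rV[R]_n ;
  cinv : 'rV[R]_n -> M ;
  chart_dom_open : open chart_dom ;
  chart_cod_open : open (cmap @` chart_dom) ;
  cmapK : forall x, chart_dom x -> cinv (cmap x) = x ;
  cmap_continuous : forall x, chart_dom x -> {for x, continuous cmap} ;
  cinv_continuous :
    forall y, (cmap @` chart_dom) y -> {for y, continuous cinv} }.

Definition chart_cod (M : topologicalType) (c : chart M) : set 'rV[R]_n :=
  cmap c @` chart_dom c.

(* The atlas need not be maximal: it has the same smooth functions as the
   maximal atlas containing it. *)
Record manifold := Manifold {
  carrier :> topologicalType ;
  manifold_hausdorff : hausdorff_space carrier ;
  manifold_second_countable : @second_countable carrier ;
  atlas : set (chart carrier) ;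
  atlas_cover : forall x : carrier, exists2 c, atlas c & chart_dom c x ;
  atlas_compatible : forall c c', atlas c -> atlas c' ->
    smooth_on (cmap c @` (chart_dom c `&` chart_dom c')) (cmap c' \o cinv c) }.

Definition smooth_fun (M : manifold) (f : M -> R) : Prop :=
  forall c, atlas c -> smooth_on (chart_cod c) (f \o cinv c).

End Manifold.

Section Ck_lemmas.
Variables (R : realType) (V : normedModType R).
Implicit Types (U : set V) (f g : V -> R).

Lemma Ck_onS k U f : Ck_on k.+1 U f -> Ck_on k U f.
Proof.
elim: k f => [|k IH] f [cf df]; split=> // v; have [d1 d2] := df v.
by split=> //; exact: IH.
Qed.

Lemma Ck_on_ext k U f g : open U -> (forall x, U x -> f x = g x) ->
  Ck_on k U f -> Ck_on k U g.
Proof.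
move=> oU; elim: k f g => [|k IH] f g fg.
  case=> cf _; split=> // x Ux.
  have nfg : \forall y \near x, f y = g y.
    by apply: filterS (open_nbhs_nbhs (conj oU Ux)) => y /fg.
  apply: cvg_trans (near_eq_cvg nfg) _.
  by rewrite -(fg x Ux); exact: cf.
move=> [cf df].
have nfg x : U x -> \forall y \near x, f y = g y.
  by move=> Ux; apply: filterS (open_nbhs_nbhs (conj oU Ux)) => y /fg.
split.
  move=> x Ux; apply: cvg_trans (near_eq_cvg (nfg x Ux)) _.
  by rewrite -(fg x Ux); exact: cf.
move=> v; have [d1 d2] := df v; split.
  by move=> x Ux; apply: near_eq_derivable (d1 x Ux); exact: nfg.
by apply: IH d2 => x Ux; apply: near_eq_derive; exact: nfg.
Qed.

Lemma Ck_on_cst k U (a : R) : open U -> Ck_on k U (cst a : V -> R).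
Proof.
have cst_c x : {for x, continuous (cst a : V -> R)} by exact: cst_continuous.
move=> oU; elim: k a cst_c => [|k IH] a cst_c; split=> // v.
split=> [x _|]; first exact: derivable_cst.
apply: (Ck_on_ext oU _ (IH 0 _)) => x *; first by rewrite derive_cst.
exact: cst_continuous.
Qed.

Lemma Ck_onD k U f g : open U -> Ck_on k U f -> Ck_on k U g ->
  Ck_on k U (f + g).
Proof.
move=> oU; elim: k f g => [|k IH] f g [cf df] [cg dg]; split=> //.
- by move=> x Ux; apply: cvgD; [exact: cf|exact: cg].
- by move=> x Ux; apply: cvgD; [exact: cf|exact: cg].
move=> v; have [df1 df2] := df v; have [dg1 dg2] := dg v; split.
  by move=> x Ux; apply: derivableD; [exact: df1|exact: dg1].
apply: (Ck_on_ext oU _ (IH _ _ df2 dg2)) => x Ux.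
by rewrite deriveD//; [exact: df1|exact: dg1].
Qed.

Lemma Ck_onM k U f g : open U -> Ck_on k U f -> Ck_on k U g ->
  Ck_on k U (f * g).
Proof.
move=> oU; elim: k f g => [|k IH] f g hf hg.
  case: hf hg => cf _ [cg _]; split=> // x Ux.
  by apply: cvgM; [exact: cf|exact: cg].
have [hf' hg'] := (Ck_onS hf, Ck_onS hg).
case: hf hg => cf df [cg dg]; split.
  by move=> x Ux; apply: cvgM; [exact: cf|exact: cg].
move=> v; have [df1 df2] := df v; have [dg1 dg2] := dg v; split.
  by move=> x Ux; apply: derivableM; [exact: df1|exact: dg1].
apply: (Ck_on_ext oU _ (Ck_onD oU (IH _ _ hf' dg2) (IH _ _ hg' df2))) => x Ux.
by rewrite deriveM//; [exact: df1|exact: dg1].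
Qed.

End Ck_lemmas.

Section Smooth_functions.
Variables (R : realType) (n : nat) (M : manifold R n).

Definition smooth_pred : {pred M -> R} := mem [set f | smooth_fun f].

Record cinf := Cinf { cinf_fun :> M -> R ; _ : cinf_fun \in smooth_pred }.

HB.instance Definition _ := [isSub for cinf_fun].
HB.instance Definition _ := [Choice of cinf by <:].

Lemma smooth_cst (a : R) : smooth_fun (cst a : M -> R).
Proof. by move=> c ac k; apply: Ck_on_cst; exact: chart_cod_open. Qed.

Lemma smooth_subring_closed : subring_closed smooth_pred.
Proof.
have sM f g : smooth_fun f -> smooth_fun g -> smooth_fun (f * g : M -> R).
  move=> sf sg c ac k.
  exact: Ck_onM (@chart_cod_open _ _ _ c) (sf c ac k) (sg c ac k).
split=> [|f g|f g]; rewrite !inE/=.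
- exact: smooth_cst.
- move=> sf sg; have -> : f - g = f + (cst (-1) * g).
    by apply/funext => x; rewrite !fctE mulN1r.
  have sNg := sM _ _ (smooth_cst (-1)) sg.
  move=> c ac k; exact: Ck_onD (@chart_cod_open _ _ _ c) (sf c ac k) (sNg c ac k).
- exact: sM.
Qed.

Lemma smooth_scaler_closed : scaler_closed smooth_pred.
Proof.
move=> a f; have [_ _ sM] := smooth_subring_closed.
by apply: sM; rewrite inE /=; exact: smooth_cst.
Qed.

HB.instance Definition _ :=
  GRing.isSubringClosed.Build _ smooth_pred smooth_subring_closed.
HB.instance Definition _ :=
  GRing.isScaleClosed.Build _ _ smooth_pred smooth_scaler_closed.
HB.instance Definition _ :=
  GRing.SubChoice_isSubComPzRing.Build (M -> R) smooth_pred cinf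
    (subringClosedP _).
HB.instance Definition _ := [SubZmodule_isSubLmodule of cinf by <:].

End Smooth_functions.

Section Tangent.
Variables (R : realType) (n : nat) (M : manifold R n).

Definition derivation_at (p : M) : {pred cinf M -> R^o} :=
  mem [set v : cinf M -> R^o |
    linear v /\ forall f g : cinf M, v (f * g) = f p * v g + g p * v f].

Record tangent (p : M) := Tangent {
  tangent_fun :> cinf M -> R^o ; _ : tangent_fun \in derivation_at p }.

HB.instance Definition _ (p : M) := [isSub for @tangent_fun p].
HB.instance Definition _ (p : M) := [Choice of tangent p by <:].

Lemma derivation_at_submod_closed (p : M) : submod_closed (derivation_at p).
Proof.
split=> [|a u v]; rewrite !inE/=.
  by split=> [b f g|f g]; rewrite ?scaler0 ?mulr0 ?addr0//=.
move=> [ul uM] [vl vM]; split=> [b f g|f g]; rewrite /= !fctE.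
  by rewrite ul vl !scalerDr addrACA !scalerA mulrC.
by rewrite uM vM !scalerDr !mulrDr addrACA -!scalerAr.
Qed.

HB.instance Definition _ (p : M) := GRing.isSubmodClosed.Build _ _
  (derivation_at p) (derivation_at_submod_closed p).
HB.instance Definition _ (p : M) :=
  [SubChoice_isSubLmodule of tangent p by <:].

Record vfield := VField {
  vfield_at :> forall p : M, tangent p ;
  vfield_smooth : forall f : cinf M, smooth_fun (fun p => vfield_at p f) }.

(* X f *)
Definition vact (X : vfield) (f : cinf M) : cinf M :=
  @Cinf R n M (fun p => X p f) (mem_set (vfield_smooth X f)).

Lemma bracket_subproof (X Y : vfield) (p : M) :
  (fun f : cinf M => X p (vact Y f) - Y p (vact X f) : R^o)
    \in derivation_at p.
Proof.
have der (Z : vfield) q : (Z q : cinf M -> R^o) \in derivation_at q.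
  by case: (Z q).
have lin (Z : vfield) q : linear (Z q).
  by have := der Z q; rewrite inE/= => -[].
have vactl (Z : vfield) a f g : vact Z (a *: f + g) = a *: vact Z f + vact Z g.
  by apply/val_inj/funext => q /=; rewrite lin.
have leib (Z : vfield) q f g : Z q (f * g) = f q * Z q g + g q * Z q f.
  by have := der Z q; rewrite inE/= => -[_]; exact.
have vactM (Z : vfield) f g : vact Z (f * g) = f * vact Z g + g * vact Z f.
  by apply/val_inj/funext => q /=; rewrite leib.
have add (Z : vfield) q f g : Z q (f + g) = Z q f + Z q g.
  by have := lin Z q 1 f g; rewrite !scale1r.
rewrite inE/=; split=> [a f g|f g].
  by rewrite !vactl !lin opprD addrACA -scalerBr.
rewrite !vactM !add !leib /=; ring.
Qed.

Lemma bracket_smooth_subproof (X Y : vfield) (f : cinf M) :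
  smooth_fun (fun p => X p (vact Y f) - Y p (vact X f)).
Proof.
by have := valP (vact X (vact Y f) - vact Y (vact X f)); rewrite inE.
Qed.

Definition bracket (X Y : vfield) : vfield :=
  @VField (fun p => Tangent (bracket_subproof X Y p))
    (bracket_smooth_subproof X Y).

Record tensor11 := Tensor11 {
  tensor11_at :> forall p : M, {linear tangent p -> tangent p} ;
  tensor11_smooth : forall (X : vfield) (f : cinf M),
    smooth_fun (fun p => tensor11_at p (X p) f) }.

Definition tensor11_app (phi : tensor11) (X : vfield) : vfield :=
  @VField (fun p => phi p (X p)) (tensor11_smooth phi X).

Record form1 := Form1 {
  form1_at :> forall p : M, {scalar tangent p} ;
  form1_smooth : forall X : vfield, smooth_fun (fun p => form1_at p (X p)) }.

Definition form1_app (eta : form1) (X : vfield) : cinf M :=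
  @Cinf R n M (fun p => eta p (X p)) (mem_set (form1_smooth eta X)).

Record tensor02 := Tensor02 {
  tensor02_at :> forall p : M, {biscalar tangent p} ;
  tensor02_smooth : forall X Y : vfield,
    smooth_fun (fun p => tensor02_at p (X p) (Y p)) }.

Record form2 := Form2 {
  form2_tensor :> tensor02 ;
  form2_alternating : forall (p : M) (v : tangent p), form2_tensor p v v = 0 }.

(* No condition on the signature, which is automatically constant on each
   connected component. *)
Record pseudo_metric := PseudoMetric {
  metric_tensor :> tensor02 ;
  metric_sym : forall (p : M) (v w : tangent p),
    metric_tensor p v w = metric_tensor p w v ;
  metric_nondegenerate : forall (p : M) (v : tangent p),
    (forall w, metric_tensor p v w = 0) -> v = 0 }.

(* The normalisation of d with the factor 1/2. *)
Definition dext (eta : form1) (X Y : vfield) : cinf M :=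
  2^-1 *: (vact X (form1_app eta Y) - vact Y (form1_app eta X)
           - form1_app eta (bracket X Y)).

Definition is_dext (eta : form1) (omega : form2) : Prop :=
  forall (X Y : vfield) (p : M), omega p (X p) (Y p) = dext eta X Y p.

Definition span1 (p : M) (v : tangent p) : set (tangent p) :=
  [set a *: v | a in [set: R]].

Definition nijenhuis (phi : tensor11) (X Y : vfield) (p : M) : tangent p :=
  bracket (tensor11_app phi X) (tensor11_app phi Y) p
  + phi p (phi p (bracket X Y p))
  - phi p (bracket (tensor11_app phi X) Y p)
  - phi p (bracket X (tensor11_app phi Y) p).

Record almost_contact_metric := AlmostContactMetric {
  acm_phi : tensor11 ;
  acm_xi : vfield ;
  acm_eta : form1 ;
  acm_g : pseudo_metric ;
  acm_eta_xi : forall p, acm_eta p (acm_xi p) = 1 ;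
  acm_phi_xi : forall p, acm_phi p (acm_xi p) = 0 ;
  acm_eta_phi : forall (X : vfield) p, acm_eta p (acm_phi p (X p)) = 0 ;
  acm_phi_phi : forall (X : vfield) p, acm_phi p (acm_phi p (X p)) =
    - X p + acm_eta p (X p) *: acm_xi p ;
  acm_g_phi : forall (X Y : vfield) p,
    acm_g p (acm_phi p (X p)) (acm_phi p (Y p)) =
    acm_g p (X p) (Y p) - acm_eta p (X p) * acm_eta p (Y p) }.

Section Contact.
Variable S : almost_contact_metric.
Let phi := acm_phi S.
Let xi := acm_xi S.
Let eta := acm_eta S.

Definition fundamental_form (p : M) (v w : tangent p) : R :=
  acm_g S p v (phi p w).

Definition contact_metric : Prop := forall (X Y : vfield) (p : M),
  fundamental_form (X p) (Y p) = dext eta X Y p.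

Definition contact_distribution (p : M) : set (tangent p) :=
  [set v | eta p v = 0].

Definition nondegenerate_on_distribution (omega : form2) : Prop :=
  forall (p : M) (v : tangent p), contact_distribution v ->
    (forall w : tangent p, contact_distribution w -> omega p v w = 0) -> v = 0.

Definition kernel_spanned_by_xi (omega : form2) : Prop :=
  forall p : M, [set v : tangent p | forall w, omega p v w = 0] = span1 (xi p).

Definition projection_on_distribution
    (P : forall p : M, {linear tangent p -> tangent p}) : Prop :=
  forall p : M,
    [/\ (forall v, P p (P p v) = P p v),
        range (P p) = @contact_distribution p &
        [set v | P p v = 0] = span1 (xi p)].

(* P is meant to be the projection TM -> D along xi. *)
Definition sasakian_new
    (P : forall p : M, {linear tangent p -> tangent p}) : Prop :=
  contact_metric /\
  forall (X Y : vfield) (p : M), P p (nijenhuis phi X Y p) = 0.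

Definition sasakian_old : Prop :=
  contact_metric /\
  forall (X Y : vfield) (p : M),
    nijenhuis phi X Y p + (2 * dext eta X Y p) *: xi p = 0.

End Contact.

End Tangent.

(* Main.v *)
Require Import Defs.
From mathcomp Require Import all_boot all_order all_algebra.
From mathcomp Require Import all_classical all_reals all_analysis.
Import GRing.Theory.
Local Open Scope ring_scope.

(** The two conditions differ only in the component of the torsion along [xi].
    The kernel of [P] is spanned by [xi], so [P (N (X, Y)) = 0] says that
    [N (X, Y)] equals [eta (N (X, Y)) *: xi], and the whole content of the
    theorem is that a contact metric structure always has
    [eta (N (X, Y)) = - 2 d eta (X, Y)] ([eta_nijenhuis]).  Indeed [eta] kills
    the image of [phi], hence every term of [N (X, Y)] but [[phi X, phi Y]],
    and for the same reason Cartan's formula reduces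
    [2 d eta (phi X, phi Y)] to [- eta [phi X, phi Y]]; finally [phi] preserves
    [d eta], which is the fundamental form, because [phi] is an isometry modulo
    [eta] ([dext_phi]).  Normality of the [xi] component is thus automatic. *)

Section Contact_metric_torsion.
Variables (R : realType) (n : nat) (M : manifold R n).

Lemma vact0 (X : vfield M) : vact X 0 = 0.
Proof.
apply/val_inj/funext => p /=; have := valP (X p); rewrite inE /= => -[lin_X _].
by have /= := lin_X (-1) 0 0; rewrite scaler0 addr0 scaleN1r addNr.
Qed.

Variable S : almost_contact_metric M.
Let phi := acm_phi S.
Let eta := acm_eta S.

Lemma form1_app_eta_phi (X : vfield M) :
  form1_app eta (tensor11_app phi X) = 0.
Proof. by apply/val_inj/funext => p /=; exact: acm_eta_phi. Qed.

(** Both derivative terms of Cartan's formula vanish, since they differentiate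
    the zero functions [eta (phi X)] and [eta (phi Y)]. *)
Lemma eta_bracket_phi (X Y : vfield M) (p : M) :
  eta p (bracket (tensor11_app phi X) (tensor11_app phi Y) p) =
  - (2 * dext eta (tensor11_app phi X) (tensor11_app phi Y) p).
Proof.
rewrite /dext !form1_app_eta_phi !vact0 subrr sub0r scalerN /= mulrN opprK.
by rewrite mulrA divff ?mul1r// pnatr_eq0.
Qed.

Lemma eta_nijenhuis_bracket (X Y : vfield M) (p : M) :
  eta p (nijenhuis phi X Y p) =
  eta p (bracket (tensor11_app phi X) (tensor11_app phi Y) p).
Proof.
have eta_phi (Z : vfield M) : eta p (phi p (Z p)) = 0 by exact: acm_eta_phi.
rewrite /nijenhuis 2!linearB linearD.
rewrite (eta_phi (tensor11_app phi (bracket X Y))).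
rewrite (eta_phi (bracket X (tensor11_app phi Y))).
by rewrite (eta_phi (bracket (tensor11_app phi X) Y)) addr0 !subr0.
Qed.

Hypothesis S_contact : contact_metric S.

(** The defect of [phi] from being an isometry is [eta (X) * eta (phi Y)],
    which is zero. *)
Lemma dext_phi (X Y : vfield M) (p : M) :
  dext eta (tensor11_app phi X) (tensor11_app phi Y) p = dext eta X Y p.
Proof.
rewrite -!S_contact /fundamental_form /=.
rewrite (acm_g_phi S X (tensor11_app phi Y)) /=.
by rewrite (acm_eta_phi S Y) mulr0 subr0.
Qed.

Lemma eta_nijenhuis (X Y : vfield M) (p : M) :
  eta p (nijenhuis phi X Y p) = - (2 * dext eta X Y p).
Proof. by rewrite eta_nijenhuis_bracket eta_bracket_phi dext_phi. Qed.

End Contact_metric_torsion.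

Theorem theorem7 (R : realType) (n : nat) (n_odd : odd n) (X : manifold R n)
    (S : almost_contact_metric X) (S_contact : contact_metric S)
    (omega : form2 X) (omega_dext : is_dext (acm_eta S) omega)
    (omega_nondegenerate : nondegenerate_on_distribution S omega)
    (omega_kernel : kernel_spanned_by_xi S omega)
    (P : forall p : X, {linear tangent p -> tangent p})
    (P_projection : projection_on_distribution S P) :
  sasakian_new S P <-> sasakian_old S.
Proof.
have kerP (p : X) (v : tangent p) : P p v = 0 <-> span1 (acm_xi S p) v.
  by have [_ _ <-] := P_projection p.
split=> -[_ torsion0]; split=> // Y Z p.
  have /kerP[a _ N_xi] := torsion0 Y Z p.
  have := eta_nijenhuis _ _ _ _ S_contact Y Z p.
  rewrite -N_xi linearZ /= acm_eta_xi => aE.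
  have -> : a = - (2 * dext (acm_eta S) Y Z p) by rewrite -aE; exact/esym/mulr1.
  by rewrite scaleNr addNr.
apply/kerP; exists (- (2 * dext (acm_eta S) Y Z p)) => //.
by rewrite scaleNr; apply/esym/eqP; rewrite -addr_eq0; apply/eqP/torsion0.
Qed.
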